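(* Let $X$ be a locally compact non-compact metrizable space. Then $|\mathcal{E}_K(X)|\leq w(X)^{\aleph_0}$, where $w(X)$ is the weight of $X$. Furthermore, if $X$ is non-separable or zero-dimensional, then equality holds.
   Context: For a non-compact metrizable space $X$, $\mathcal{E}(X)$ denotes the set of all one-point metrizable extensions of $X$, i.e. metrizable spaces $Y=X\cup\{p\}$ with $p\notin X$ containing $X$ as a dense subspace, where two such extensions are identified if there is a homeomorphism between them fixing $X$ pointwise. For $X$ locally compact, $\mathcal{E}_K(X)$ is the set of those elements of $\mathcal{E}(X)$ that are locally compact. A space is zero-dimensional if it has a base of clopen sets. *)

(* Defs.v *)
From HB Require Import structures.
From mathcomp Require Import all_boot all_order all_algebra.
From mathcomp Require Import all_classical all_reals all_analysis.

Set Implicit Arguments.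
Unset Strict Implicit.
Unset Printing Implicit Defensive.

Import Order.TTheory GRing.Theory Num.Theory.
Local Open Scope classical_set_scope.
Local Open Scope ring_scope.
Local Open Scope card_scope.

Definition metrizable (R : realType) (X : topologicalType) : Prop :=
  exists d : X -> X -> R,
    [/\ forall x y, d x y = 0 <-> x = y,
        forall x y, d x y = d y x,
        forall x y z, d x z <= d x y + d y z
      & forall (x : X) (A : set X),
          nbhs x A <-> exists2 e : R, 0 < e & [set y | d x y < e] `<=` A].

Definition separable (X : topologicalType) : Prop :=
  exists2 D : set X, countable D & dense D.

(* The library's [zero_dimensional] only separates points by clopen sets, which
   in general is weaker than having a base of clopen sets. *)
Definition has_clopen_basis (X : topologicalType) : Prop :=
  exists2 B : set (set X), basis B & B `<=` clopen.

Definition homeomorphism (X Y : topologicalType) (h : X -> Y) : Prop :=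
  continuous h /\
  exists g : Y -> X, [/\ cancel h g, cancel g h & continuous g].

(* The sequences in A: their set has cardinality |A|^aleph_0. *)
Definition sequences_in (T : Type) (A : set T) : set (nat -> T) :=
  [set u | range u `<=` A].

Definition least_basis (X : topologicalType) (B : set (set X)) : Prop :=
  basis B /\ forall B' : set (set X), basis B' -> B #<= B'.

(* There is no type of cardinals: the weight is represented by a base of least
   cardinality, which exists by [least_basis_ex] below. *)
Definition weight (X : topologicalType) : set (set X) :=
  get (@least_basis X).
Arguments weight : clear implicits.

Lemma set_inj_card_le (T U : Type) (A : set T) (B : set U) (f : T -> U) :
  set_fun A B f -> set_inj A f -> A #<= B.
Proof.
move=> fAB fA; have [g] := (injfunPex (A := A) (B := B)).2 (ex_intro2 _ _ f fAB fA).
exact: inj_card_le g.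
Qed.

(* A maximal set S of choice functions on which every evaluation is injective
   must be mapped onto some member of F. *)
Lemma card_le_least (T : Type) (F : set (set T)) : F !=set0 ->
  exists2 A, F A & forall B, F B -> A #<= B.
Proof.
move=> [A0 FA0].
pose good (S : set (set T -> T)) := forall A, F A ->
  set_fun S A (fun s => s A) /\ set_inj S (fun s => s A).
have [|S [gS maxS]] := @Zorn_bigcup _ good.
  move=> C Cgood Ctot A FA; split => [s [S CS Ss]|s t].
    exact: ((Cgood _ CS _ FA).1 _ Ss).
  rewrite !inE => -[S CS Ss] [S' CS' S't] st.
  have [SS'|S'S] := Ctot _ _ CS CS'.
    by apply: ((Cgood _ CS' _ FA).2) => //; rewrite inE //; exact: SS'.
  by apply: ((Cgood _ CS _ FA).2) => //; rewrite inE //; exact: S'S.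
have [A FA /= onto] : exists2 A, F A & set_surj S A (fun s => s A).
  apply: contrapT => no.
  have ex A : exists a, F A -> A a /\ forall s, S s -> s A <> a.
    have [FA|nFA] := pselect (F A); last first.
      have [[a _]|E] := pselect (exists a : T, True); first by exists a.
      have : exists2 A, F A & set_surj S A (fun s => s A).
        by exists A0 => // a; exfalso; apply: E; exists a.
      by move/no.
    apply: contrapT => nex; apply: no; exists A => // a Aa.
    apply: contrapT => na; apply: nex; exists a => _; split => // s Ss sa.
    by apply: na; exists s.
  pose t A := projT1 (cid (ex A)).
  have tP A : F A -> A (t A) /\ forall s, S s -> s A <> t A.
    exact: (projT2 (cid (ex A))).
  apply: (maxS (S `|` [set t])).
    rewrite properEneq; split; last by move=> s; left.
    apply/eqP => E; have St : S t by rewrite E; right.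
    exact: ((tP _ FA0).2 _ St).
  move=> A FA; split.
    by move=> s [Ss|->]; [exact: (gS _ FA).1 | exact: (tP _ FA).1].
  move=> s s'; rewrite !inE => -[Ss|->] [Ss'|->] // E.
  - by apply: (gS _ FA).2 => //; rewrite inE.
  - by case: ((tP _ FA).2 _ Ss).
  - by case: ((tP _ FA).2 _ Ss').
exists A => // B FB.
have [fA iA] := gS _ FA; have [fB iB] := gS _ FB.
apply: (@card_le_trans _ _ _ S).
  have /choice[r rP] a : exists s, A a -> S s /\ s A = a.
    have [Aa|nAa] := pselect (A a); last by exists (fun=> a) => /nAa.
    by have [s Ss sa] := onto a Aa; exists s.
  apply: set_inj_card_le (_ : set_fun A S r) _.
    by move=> a /rP[].
  move=> a b; rewrite !inE => Aa Ab E.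
  by rewrite -(rP _ Aa).2 -(rP _ Ab).2 E.
exact: set_inj_card_le fB iB.
Qed.

Lemma least_basis_ex (X : topologicalType) :
  exists B : set (set X), least_basis B.
Proof.
have [|B bB leB] := @card_le_least (set X) (@basis X); last by exists B.
exists open; split => // x A; rewrite nbhsE => -[U [oU Ux] UA].
by exists U.
Qed.

Lemma weightP (X : topologicalType) : least_basis (weight X).
Proof. by have [B /getI] := least_basis_ex X. Qed.

Record topology (T : Type) := Topology {
  topology_open : set (set T);
  topology_openT : topology_open [set: T];
  topology_openI : setI_closed topology_open;
  topology_open_bigcup : forall F : set (set T),
    F `<=` topology_open -> topology_open (\bigcup_(A in F) A) }.

(* T with t as its topology; the original topology of T, if any, is forgotten. *)
Definition tspace (T : Type) (t : topology T) : Type := T.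

Section tspace.
Variables (T : choiceType) (t : topology T).

Let tspace_bigU (I : Type) (f : I -> set T) :
  (forall i, topology_open t (f i)) -> topology_open t (\bigcup_i f i).
Proof.
move=> tf; rewrite -(bigcup_image setT f id).
by apply: topology_open_bigcup => _ [i _ <-].
Qed.

HB.instance Definition _ := Choice.copy (tspace t) T.
HB.instance Definition _ := isOpenTopological.Build (tspace t)
  (topology_openT t) (@topology_openI _ t) tspace_bigU.

Lemma open_tspaceE : @open (tspace t) = topology_open t.
Proof. by []. Qed.

End tspace.

Section one_point_extensions.
Variables (R : realType) (X : topologicalType).

(* The underlying set of an extension of X by a point p is option X, where
   Some x stands for the point x of X and None stands for p. *)
Definition extension (Y : topology (option X)) : Prop :=
  [/\ metrizable R (tspace Y),
      @open X = [set (Some : X -> tspace Y) @^-1` U | U in @open (tspace Y)]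
    & dense (range (Some : X -> tspace Y))].

Definition ext_equiv (Y Z : topology (option X)) : Prop :=
  exists2 h : tspace Y -> tspace Z,
    homeomorphism h & forall x : X, h (Some x) = Some x.

Definition ext_class (Y : topology (option X)) : set (topology (option X)) :=
  [set Z | extension Z /\ ext_equiv Y Z].

Definition extensions : set (set (topology (option X))) :=
  [set ext_class Y | Y in extension].

Definition lc_extensions : set (set (topology (option X))) :=
  [set c | extensions c /\
           forall Y, c Y -> locally_compact [set: tspace Y]].

End one_point_extensions.

Arguments extensions : clear implicits.
Arguments lc_extensions : clear implicits.

(* Main.v *)
Require Import Defs.
From mathcomp Require Import all_boot all_order all_algebra.
From mathcomp Require Import all_classical all_reals all_analysis.
From mathcomp Require Import lra.
Set Implicit Arguments.
Unset Strict Implicit.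
Unset Printing Implicit Defensive.
Import Order.TTheory GRing.Theory Num.Theory.
Local Open Scope classical_set_scope.
Local Open Scope ring_scope.
Local Open Scope card_scope.

(** A metrizable extension of X by a point p is determined by the neighbourhoods
    of p ([extension_openP]), and two equivalent extensions are equal
    ([ext_equiv_eq]).

    Upper bound.  If the extension is locally compact, small punctured balls
    at p are unions of countably many compact sets of X, so the neighbourhoods
    of p are generated by countable unions of members of a given base of X
    ([extension_code]).  Hence a sequence in a base of least cardinality
    determines the extension.

    Lower bound.  Suppose that X is partitioned into infinitely many clopen
    sigma-compact pieces, which are the fibres of a locally constant map c
    ([fibered_exhaustion]).  A sequence of distinct pieces gives a locally
    compact extension in which these pieces converge to p and every other piece
    stays away from p ([extension_along]); its metric comes from a general
    construction ([pinched]) that adds to a metric space a point at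
    prescribed weights.  The weight of X is at most the number of pieces
    ([fibered_weight]), so a sequence f in the least base can be read as a
    sequence of indices of pieces.  An infinite set has as many finite sequences
    as elements ([card_seqs_in]), so each initial segment of f has a piece
    of its own as its code; taking the pieces coded by the initial segments of
    f makes the families of pieces for different f almost disjoint, and the
    extensions different ([card_sequences_le_lc_extensions]).

    Such partitions exist in both cases.  In a locally compact metric space, the
    classes of points joined by finite chains of short links are clopen
    and sigma-compact ([fibered_exhaustion_ex]); if there are only countably
    many of them, X is separable ([fibered_separable]).  If X is separable with
    a clopen base, a countable cover by compact open sets, made disjoint,
    has infinitely many nonempty pieces since X is not compact
    ([fibered_exhaustion_clopen]). *)

(** * Cardinality of the set of finite sequences *)

(** Among two sets of the same type one has least cardinality, and that one
    injects into the other. *)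
Lemma card_le_total (T : Type) (A B : set T) : A #<= B \/ B #<= A.
Proof.
have [|C [->|->] leC] := @card_le_least T [set A; B]; first by exists A; left.
- by left; apply: leC; right.
- by right; apply: leC; left.
Qed.

(** Cardinal comparison is an injection between subtypes; the value of the
    extension outside [A] is arbitrary, hence the inhabitant of [B]. *)
Lemma card_le_fun (T U : Type) (A : set T) (B : set U) :
  A #<= B -> B !=set0 ->
  exists2 f : T -> U, set_fun A B f & set_inj A f.
Proof.
move=> /card_leP[f] [u0 _].
exists (fun x => if pselect (A x) is left Ax then
  val (f (SigSub (mem_set Ax))) else u0) => [x Ax|x y].
  case: pselect => // {}Ax; exact: set_valP.
rewrite !inE => Ax Ay; case: pselect => // {}Ax; case: pselect => // {}Ay.
by move=> /val_inj fE; case: (inj (in_setT _) (in_setT _) fE).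
Qed.

Definition seqs_in (T : eqType) (A : set T) : set (seq T) :=
  [set s | forall x, x \in s -> A x].

Lemma seqs_in_cons (T : eqType) (A : set T) x s :
  seqs_in A (x :: s) <-> A x /\ seqs_in A s.
Proof.
split=> [H|[Ax As] y].
  by split=> [|y ys]; apply: H; rewrite inE ?eqxx ?ys ?orbT.
by rewrite inE => /orP[/eqP->//|]; exact: As.
Qed.

(** Replacing each letter by a word of length two is a uniquely decodable code.
    With two letters b0 <> b1 of B as markers, sending x in B to b0 x and the
    twin of x in a disjoint copy of B to b1 x codes the words over B and its
    copy by words over B. *)
Lemma flatten_map2_inj (T : eqType) (A : set T) (h1 h2 : T -> T) s t :
  (forall x y, A x -> A y -> h1 x = h1 y -> h2 x = h2 y -> x = y) ->
  seqs_in A s -> seqs_in A t ->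
  flatten [seq [:: h1 x; h2 x] | x <- s] =
  flatten [seq [:: h1 x; h2 x] | x <- t] -> s = t.
Proof.
move=> hI; elim: s t => [|x s IH] [|y t] //=.
move=> /seqs_in_cons[Ax As] /seqs_in_cons[Ay At] [E1 E2 E].
by rewrite (hI _ _ Ax Ay E1 E2) (IH _ As At E).
Qed.

Lemma seqs_in_flatten (T : eqType) (A B : set T) (h1 h2 : T -> T) s :
  (forall x, A x -> B (h1 x) /\ B (h2 x)) -> seqs_in A s ->
  seqs_in B (flatten [seq [:: h1 x; h2 x] | x <- s]).
Proof.
move=> hB; elim: s => [|x s IH] //= /seqs_in_cons[/hB[B1 B2] /IH Bs].
by apply/seqs_in_cons; split=> //; apply/seqs_in_cons.
Qed.


(** Zorn's lemma applied to the pairs (B, f) where B is an infinite subset of A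
    and f codes the finite sequences of B injectively by elements of B; f is a
    total function, and only its values on the sequences of B matter. *)
Section seq_card.
Variables (T : choiceType) (A : set T).

Let good (p : set T * (seq T -> T)) :=
  [/\ p.1 `<=` A, infinite_set p.1, forall s, seqs_in p.1 s -> p.1 (p.2 s)
    & forall s t, seqs_in p.1 s -> seqs_in p.1 t -> p.2 s = p.2 t -> s = t].

Let coding := {p | good p}.
Let extends (p q : coding) : bool := `[< (sval p).1 `<=` (sval q).1 /\
  forall s, seqs_in (sval p).1 s -> (sval q).2 s = (sval p).2 s >].

Let coding0 : infinite_set A -> coding.
Proof.
move=> infA; have [x0 Ax0] := cid (infinite_setN0 infA).
have /cid2[f fA fI] := card_le_fun ((infiniteP _).1 infA) (infinite_setN0 infA).
have fK x y : f x = f y -> x = y by apply: fI; rewrite inE.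
pose g (y : T) : nat := if pselect (exists n, f n = y) is left h
  then sval (cid h) else 0%N.
have gK n : g (f n) = n.
  rewrite /g; case: pselect => [h|[]]; last by exists n.
  by apply: fK; exact: (svalP (cid h)).
exists (range f, fun s => f (pickle (map g s))); split => /=.
- by move=> _ [n _ <-]; exact: fA.
- by apply/infiniteP/(set_inj_card_le (f := f)) => // n _; exists n.
- by move=> s _; exists (pickle (map g s)).
move=> s t sf tf /fK/(pcan_inj pickleK).
have fg r : seqs_in (range f) r -> map f (map g r) = r.
  elim: r => //= x r IH /seqs_in_cons[[n _ <-] /IH ->].
  by rewrite gK.
by move=> /(congr1 (map f)); rewrite !fg.
Qed.

Let chain_ub (C : set coding) : coding -> total_on C extends ->
  exists p, forall q, C q -> extends q p.
Proof.
move=> p0 totC.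
have [[p1 Cp1]|noC] := pselect (exists p, C p); last first.
  by exists p0 => q Cq; case: noC; exists q.
have common s : seqs_in (\bigcup_(p in C) (sval p).1) s ->
    exists2 p, C p & seqs_in (sval p).1 s.
  elim: s => [|x s IH]; first by exists p1.
  move=> /seqs_in_cons[[p Cp px] /IH[q Cq qs]].
  have [/asboolP[pq _]|/asboolP[qp _]] := totC _ _ Cp Cq.
    by exists q => //; apply/seqs_in_cons; split=> //; exact: pq.
  by exists p => //; apply/seqs_in_cons; split=> // y /qs /qp.
pose f s := if pselect (exists2 p, C p & seqs_in (sval p).1 s) is left h
  then (sval (s2val (cid2 h))).2 s else (sval p1).2 s.
have fE p s : C p -> seqs_in (sval p).1 s -> f s = (sval p).2 s.
  move=> Cp ps; rewrite /f; case: pselect => [h|[]]; last by exists p.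
  case: (cid2 h) => q Cq qs /=.
  by have [/asboolP[_ /(_ _ ps)]|/asboolP[_ /(_ _ qs)]] := totC _ _ Cp Cq.
have gf : good (\bigcup_(p in C) (sval p).1, f).
  split => /=.
  - by move=> x [p Cp px]; case: (svalP p) => /(_ _ px).
  - have [_ inf1 _ _] := svalP p1; apply: sub_infinite_set inf1.
    by move=> x px; exists p1.
  - move=> s /common[p Cp ps]; exists p => //; rewrite (fE _ _ Cp ps).
    by case: (svalP p) => _ _ /(_ _ ps).
  move=> s t /common[p Cp ps] /common[q Cq qt].
  have [/asboolP[pq _]|/asboolP[qp _]] := totC _ _ Cp Cq.
    have qs : seqs_in (sval q).1 s by move=> y /ps/pq.
    rewrite (fE _ _ Cq qs) (fE _ _ Cq qt).
    by case: (svalP q) => _ _ _; exact.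
  have pt : seqs_in (sval p).1 t by move=> y /qt/qp.
  rewrite (fE _ _ Cp ps) (fE _ _ Cp pt).
  by case: (svalP p) => _ _ _; exact.
exists (exist _ _ gf) => q Cq; apply/asboolP; split => /= [x qx|s qs].
  by exists q.
exact: fE.
Qed.

(** For a maximal coding on B, either B is at least as large as the rest of A, and
    coding the letters of A by pairs of letters of B finishes the proof, or the rest
    of A contains a copy of B.  In the second case the coding extends to the
    union of B and its copy, the new sequences being coded in the copy. *)
Lemma card_seqs_in : infinite_set A -> seqs_in A #<= A.
Proof.
move=> infA; have p0 := coding0 infA.
have [[[B f] gf] maxp] : exists p : coding, premaximal extends p.
  apply: (ZL_preorder p0).
  - by move=> p; apply/asboolP; split.
  - move=> q p r /asboolP[qp qpE] /asboolP[pr prE]; apply/asboolP.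
    split=> [|s qs]; first exact: subset_trans pr.
    by rewrite prE ?qpE// => y /qs/qp.
  - by move=> C; exact: chain_ub.
have [/= BA infB fB fI] := gf.
have [b0 [b1 [Bb0 Bb1 /eqP b01]]] : exists b0 b1, [/\ B b0, B b1 & b0 <> b1].
  have /infiniteP iB := infB.
  have [h hB hI] := card_le_fun iB (infinite_setN0 infB).
  exists (h 0%N), (h 1%N); split; [exact: hB|exact: hB|].
  by move/hI; rewrite !inE => /(_ I I).
have [AB|BA'] := card_le_total (A `\` B) B.
  have [h hB hI] := card_le_fun AB (infinite_setN0 infB).
  pose h1 x := if pselect (B x) is left _ then b0 else b1.
  pose h2 x := if pselect (B x) is left _ then x else h x.
  have hP x : A x -> B (h1 x) /\ B (h2 x).
    move=> Ax; rewrite /h1 /h2; case: pselect => // nBx.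
    by split=> //; exact: hB.
  (* A embeds into the words of length two over B. *)
  apply: (set_inj_card_le
    (f := fun s => f (flatten [seq [:: h1 x; h2 x] | x <- s]))).
    by move=> s As; apply/BA/fB; exact: seqs_in_flatten As.
  move=> s t; rewrite !inE => As At /fI E.
  have flB r : seqs_in A r ->
      seqs_in B (flatten [seq [:: h1 x; h2 x] | x <- r]).
    exact: seqs_in_flatten.
  apply: flatten_map2_inj As At (E (flB _ As) (flB _ At)).
  move=> x y Ax Ay; rewrite /h1 /h2.
  case: pselect => Bx; case: pselect => By //.
  - by move=> /eqP; rewrite (negbTE b01).
  - by move=> /eqP; rewrite eq_sym (negbTE b01).
  - by move=> _; apply: hI; rewrite inE.
have nzAB : A `\` B !=set0.
  have [x Bx] := infinite_setN0 infB; have /card_leP[i] := BA'.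
  by exists (val (i (SigSub (mem_set Bx)))); exact: set_valP.
have [h hA hI] := card_le_fun BA' nzAB.
pose B' := B `|` h @` B.
pose k y := if pselect (exists2 x, B x & h x = y) is left w
  then s2val (cid2 w) else y.
have kK x : B x -> k (h x) = x.
  move=> Bx; rewrite /k; case: pselect => [w|[]]; last by exists x.
  by case: (cid2 w) => y By hyx /=; apply: hI; rewrite ?inE.
pose h1 x := if pselect (B x) is left _ then b0 else b1.
pose h2 x := if pselect (B x) is left _ then x else k x.
have nBh x : B x -> ~ B (h x) by move=> /hA[].
have hP x : B' x -> B (h1 x) /\ B (h2 x).
  rewrite /h1 /h2; case: pselect => // nBx [//|[y By <-]].
  by rewrite kK.
have h12I x y : B' x -> B' y -> h1 x = h1 y -> h2 x = h2 y -> x = y.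
  rewrite /h1 /h2; case: pselect => Bx; case: pselect => By //.
  - by move=> _ _ /eqP; rewrite (negbTE b01).
  - by move=> _ _ /eqP; rewrite eq_sym (negbTE b01).
  - by move=> [//|[x' Bx' <-]] [//|[y' By' <-]] _; rewrite !kK// => ->.
pose fl s := flatten [seq [:: h1 x; h2 x] | x <- s].
have flB s : seqs_in B' s -> seqs_in B (fl s) by exact: seqs_in_flatten.
pose f' s := if pselect (seqs_in B s) is left _ then f s else h (f (fl s)).
have gf' : good (B', f').
  split => /=.
  - by move=> x [/BA//|[y /hA[Ah _] <-]].
  - by apply: sub_infinite_set infB => x; left.
  - move=> s B's; rewrite /f'; case: pselect => [/fB|_]; first by left.
    by right; exists (f (fl s)) => //; exact/fB/flB.
  move=> s t B's B't; rewrite /f'.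
  case: pselect => Bs; case: pselect => Bt.
  - exact: fI.
  - by move=> E; case: (nBh (f (fl t))); [exact/fB/flB|rewrite -E; exact: fB].
  - by move=> E; case: (nBh (f (fl s))); [exact/fB/flB|rewrite E; exact: fB].
  - move=> /hI E; apply: (flatten_map2_inj h12I) => //.
    by apply: fI; [exact: flB|exact: flB|apply: E; rewrite inE; exact/fB/flB].
have /maxp/asboolP[/= B'B _] : extends (exist _ _ gf) (exist _ _ gf').
  apply/asboolP; split => /= [x|s Bs]; first by left.
  by rewrite /f'; case: pselect.
by case: (nBh _ Bb0); apply: B'B; right; exists b0.
Qed.

Lemma card_setX_nat : infinite_set A -> A `*` [set: nat] #<= A.
Proof.
move=> infA; apply: card_le_trans (card_seqs_in infA).
apply: (set_inj_card_le (f := fun xn : T * nat => nseq xn.2.+1 xn.1)).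
  by move=> [x n] [/= Ax _] y; rewrite (mem_nseq n.+1) => /andP[_ /eqP->].
by move=> [x n] [y m] _ _ /= [-> /(congr1 size)]; rewrite !size_nseq => ->.
Qed.

End seq_card.

(** * Compactness and metrics *)

Section compactness.
Variable X : topologicalType.
Implicit Types (A B K : set X) (Q : set X -> Prop).

(** If K were not in Q, the sets A with K \ A in Q would form a proper filter
    containing K; a cluster point of it in K has no neighbourhood in Q. *)
Lemma compact_induction Q K :
  Q set0 -> (forall A B, A `<=` B -> Q B -> Q A) ->
  (forall A B, Q A -> Q B -> Q (A `|` B)) -> compact K ->
  (forall x, K x -> exists2 U, nbhs x U & Q U) -> Q K.
Proof.
move=> Q0 QS QU cK locQ; apply: contrapT => nQK.
pose F : set_system X := [set A | Q (K `\` A)].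
have FF : Filter F.
  split; rewrite /F /=.
  - by rewrite setDT.
  - by move=> A B QA QB; rewrite /= setDIr; exact: QU.
  - by move=> A B AB; apply: QS; exact: setDS.
have PF : ProperFilter F.
  by apply: Build_ProperFilter_ex => A FA; apply: contrapT => /forallNP A0;
    apply: nQK; apply: QS FA => x Kx; split=> //; exact: A0.
have FK : F K by rewrite /F /= setDv.
have [x [Kx clx]] := cK F PF FK.
have [U xU QU'] := locQ x Kx.
have FU : F (~` U) by apply: QS QU' => y [_ /contrapT].
by have [y [nUy Uy]] := clx _ _ FU xU.
Qed.

Definition relatively_compact A := exists2 K, compact K & A `<=` K.

Lemma relatively_compactS A B :
  A `<=` B -> relatively_compact B -> relatively_compact A.
Proof. by move=> AB [K cK BK]; exists K => //; exact: subset_trans BK. Qed.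

Lemma relatively_compactU A B : relatively_compact A ->
  relatively_compact B -> relatively_compact (A `|` B).
Proof.
move=> [K cK AK] [L cL BL]; exists (K `|` L); first exact: compactU.
exact: setUSS.
Qed.

Lemma relatively_compact0 : relatively_compact set0.
Proof. by exists set0 => //; exact: compact0. Qed.

Lemma relatively_compact_bigcup (I : choiceType) (D : set I) (F : I -> set X) :
  finite_set D -> (forall i, D i -> relatively_compact (F i)) ->
  relatively_compact (\bigcup_(i in D) F i).
Proof.
move=> /finite_seqP[s ->]; elim: s => [|i s IH] rF.
  by apply: relatively_compactS relatively_compact0 => x [].
apply: relatively_compactS (relatively_compactU (rF i _) (IH _)).
- move=> x [j /=]; rewrite inE => /orP[/eqP->|js] Fx; first by left.
  by right; exists j.
- by rewrite /= inE eqxx.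
- by move=> j /= js; apply: rF; rewrite /= inE js orbT.
Qed.

End compactness.

Section metric.
Variables (R : realType) (X : topologicalType).

(** [metrizable] with the metric named: the constructions below combine the
    values of several metrics on the same space. *)
Definition metrizes (d : X -> X -> R) : Prop :=
  [/\ forall x y, d x y = 0 <-> x = y,
      forall x y, d x y = d y x,
      forall x y z, d x z <= d x y + d y z
    & forall (x : X) (A : set X),
        nbhs x A <-> exists2 e : R, 0 < e & [set y | d x y < e] `<=` A].

Variable d : X -> X -> R.
Hypothesis dX : metrizes d.

Lemma mdxx x : d x x = 0. Proof. by have [d0 _ _ _] := dX; apply/d0. Qed.
Lemma mdC x y : d x y = d y x. Proof. by have [] := dX. Qed.
Lemma mdtri y x z : d x z <= d x y + d y z. Proof. by have [] := dX. Qed.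
Lemma md_ge0 x y : 0 <= d x y.
Proof. have := mdtri y x x; rewrite mdxx (mdC y x); lra. Qed.
Lemma md0 x y : d x y = 0 -> x = y.
Proof. by have [d0 _ _ _] := dX => /d0. Qed.
Lemma md_gt0 x y : x <> y -> 0 < d x y.
Proof.
by move=> xy; rewrite lt_neqAle md_ge0 andbT eq_sym; apply/eqP => /md0.
Qed.
Lemma mnbhsP x (A : set X) :
  nbhs x A <-> exists2 e : R, 0 < e & [set y | d x y < e] `<=` A.
Proof. by have [] := dX. Qed.
Lemma mnbhs_ball x e : 0 < e -> nbhs x [set y | d x y < e].
Proof. by move=> e0; apply/mnbhsP; exists e. Qed.

Lemma open_ltP (f : X -> R) (b : R) :
  (forall x y, f y <= f x + d x y) -> open [set y | f y < b].
Proof.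
move=> fL; rewrite openE => y /= fy; apply/mnbhsP.
exists (b - f y); first by rewrite subr_gt0.
by move=> z /=; have := fL y z; lra.
Qed.

Lemma open_mball x e : open [set y | d x y < e].
Proof. by apply: open_ltP => y z; exact: mdtri. Qed.

Lemma lipschitz_closed (f : X -> R) (a b : R) :
  (forall x y, f y <= f x + d x y) -> closed [set y | a <= f y <= b].
Proof.
move=> fL; rewrite -[X in closed X]setCK; apply: open_closedC.
rewrite (_ : ~` _ = [set y | f y < a] `|` [set y | - f y < - b]).
  apply: openU; apply: open_ltP => // x y /=; have := fL y x.
  by rewrite mdC; lra.
apply/seteqP; split => y /=; rewrite ltrN2.
  by move/negP; rewrite negb_and -!ltNge => /orP.
by move=> yab; apply/negP; rewrite negb_and -!ltNge; apply/orP.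
Qed.

Lemma metrizes_hausdorff : hausdorff_space X.
Proof.
move=> x y cl; apply: contrapT => /md_gt0 dxy.
have e0 : 0 < d x y / 2 by lra.
have [z [/= xz yz]] := cl _ _ (mnbhs_ball x e0) (mnbhs_ball y e0).
by have := mdtri z x y; rewrite (mdC z y); lra.
Qed.

(** [locally_compact] asks for compact neighbourhoods that are also closed; here
    they are, because the space is Hausdorff. *)
Lemma metrizes_locally_compact :
  (forall x : X, exists2 U, nbhs x U & relatively_compact U) ->
  locally_compact [set: X].
Proof.
move=> lc x _; have [U xU [K cK UK]] := lc x.
exists K; last first.
  by split=> //; apply: compact_closed cK; exact: metrizes_hausdorff.
suff : nbhs x [set y | [set: X] y -> K y] by [].
by apply: filterS xU => y Uy _; exact: UK.
Qed.

End metric.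

Lemma locally_compact_nbhs (X : topologicalType) (x : X) :
  locally_compact [set: X] -> exists2 K, nbhs x K & compact K /\ closed K.
Proof.
move=> /(_ x I)[K xK [cK clK]]; exists K => //.
have {}xK : nbhs x [set y | [set: X] y -> K y] by [].
by apply: filterS xK => y; exact.
Qed.

(** * Extensions and their codes by sequences of basic sets *)

Section extensions_topology.
Variables (R : realType) (X : topologicalType).
Implicit Types Y Z : topology (option X).

Lemma extension_continuous Y : extension R Y ->
  continuous (Some : X -> tspace Y).
Proof.
move=> [_ oE _]; apply/continuousP => U oU.
by rewrite oE; exists U.
Qed.

Lemma extension_nbhs Y (x : X) (A : set X) : extension R Y -> nbhs x A ->
  exists2 U : set (tspace Y), nbhs (Some x : tspace Y) U & Some @^-1` U `<=` A.
Proof.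
move=> [_ oE _]; rewrite nbhsE => -[V [+ Vx] VA]; rewrite oE => -[U oU UV].
exists U; last by rewrite UV.
by apply: open_nbhs_nbhs; split => //; move: Vx; rewrite -UV.
Qed.

(** In a metrizable extension the added point is closed, so deleting it from an
    open set leaves an open set. Hence the topology is known from the topology
    of X and from the neighbourhoods of the added point. *)
Lemma extension_openP Y (U : set (option X)) : extension R Y ->
  topology_open Y U <->
  open (Some @^-1` U) /\ (U None -> nbhs (None : tspace Y) U).
Proof.
move=> eY; split.
  rewrite -open_tspaceE => oU; split; last by move=> UN; apply: open_nbhs_nbhs.
  by move/continuousP: (extension_continuous eY); exact.
move=> [oU UN]; rewrite -open_tspaceE openE => -[x|]; last exact: UN.
move=> Ux; have [[d dY] _ _] := eY.
have /(extension_nbhs eY)[V xV VU] : nbhs x (Some @^-1` U).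
  exact: open_nbhs_nbhs.
have xN : 0 < d (Some x) None by apply: (md_gt0 dY).
apply: filterS (filterI xV (mnbhs_ball dY (Some x) xN)) => -[y|] [/=].
  by move=> Vy _; exact: VU.
by rewrite ltxx.
Qed.

Lemma topology_eqP (T : Type) (t s : topology T) :
  topology_open t = topology_open s -> t = s.
Proof.
case: t s => [F oT oI oU] [G oT' oI' oU'] /= E.
case: G / E oT' oI' oU' => oT' oI' oU'.
by rewrite (Prop_irrelevance oT oT') (Prop_irrelevance oI oI')
  (Prop_irrelevance oU oU').
Qed.

Lemma extension_eq Y Z : extension R Y -> extension R Z ->
  nbhs (None : tspace Y) = nbhs (None : tspace Z) -> Y = Z.
Proof.
move=> eY eZ nE; apply: topology_eqP; apply/seteqP; split => U.
  move/(extension_openP _ eY) => [oU UN]; apply/(extension_openP _ eZ).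
  by split => // /UN; rewrite nE.
move/(extension_openP _ eZ) => [oU UN]; apply/(extension_openP _ eY).
by split => // /UN; rewrite nE.
Qed.

(** A homeomorphism over X also fixes the added point, so it is the identity:
    each class of equivalent extensions has only one element. *)
Lemma ext_equiv_eq Y Z : extension R Y -> extension R Z ->
  ext_equiv Y Z -> Y = Z.
Proof.
move=> eY eZ [h [ch [g [hK gK cg]]] hS].
have hN : h None = None.
  case E : (h None) => [x|//]; have := hK None; rewrite E.
  by rewrite -(hS x) hK.
have hE a : h a = a by case: a.
have gE a : g a = a by rewrite -[in LHS](hE a) hK.
apply: extension_eq => //; apply/seteqP; split => U UN.
  have <- : g @^-1` U = U by apply/funext => a /=; rewrite gE.
  by apply: cg; rewrite gE.
have <- : h @^-1` U = U by apply/funext => a /=; rewrite hE.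
by apply: ch; rewrite hE.
Qed.

Lemma ext_equiv_refl Y : ext_equiv Y Y.
Proof.
have cid : continuous (id : tspace Y -> tspace Y) by move=> x; exact: cvg_id.
by exists id => //; split=> //; exists id.
Qed.

Lemma ext_class_lc Y : extension R Y -> locally_compact [set: tspace Y] ->
  lc_extensions R X (ext_class R Y).
Proof.
move=> eY lcY; split; first by exists Y.
by move=> Z [eZ /(ext_equiv_eq eY eZ)<-].
Qed.

Lemma ext_class_inj Y Z : extension R Y -> extension R Z ->
  ext_class R Y = ext_class R Z -> Y = Z.
Proof.
move=> eY eZ E; have [_] : ext_class R Y Z.
  by rewrite E; split=> //; exact: ext_equiv_refl.
exact: ext_equiv_eq.
Qed.

End extensions_topology.

Lemma compact_cover_basis (X : topologicalType) (B : set (set X))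
    (K U : set X) :
  basis B -> compact K -> K `<=` U -> open U ->
  exists S : set (set X), [/\ countable S, S `<=` B,
    K `<=` \bigcup_(V in S) V & \bigcup_(V in S) V `<=` U].
Proof.
move=> basisB cK KU oU.
apply: (@compact_induction _ (fun A => exists S : set (set X),
  [/\ countable S, S `<=` B, A `<=` \bigcup_(V in S) V
    & \bigcup_(V in S) V `<=` U])) cK _.
- by exists set0; split=> [|? []|? []|? [? []]]; exact: countable0.
- move=> A C AC [S [cS SB CS SU]]; exists S; split=> //.
  exact: subset_trans CS.
- move=> A C [S [cS SB AS SU]] [S' [cS' SB' CS' SU']].
  exists (S `|` S'); split.
  + rewrite -bigcup2E; apply: bigcup_countable; first exact: countableP.
    by move=> [|[|i]] _ //=; exact: countable0.
  + by move=> V [/SB|/SB'].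
  + by move=> x [/AS|/CS'] [V SV Vx]; exists V => //; [left|right].
  + by move=> x [V [SV|SV'] Vx]; [apply: SU|apply: SU']; exists V.
move=> x Kx; have xU : nbhs x U by apply: open_nbhs_nbhs; split=> //; exact: KU.
have [Bo /(_ x U xU)[V [BV Vx] VU]] := basisB.
exists V; first by apply: open_nbhs_nbhs; split=> //; exact: Bo.
exists [set V]; split.
- exact: countable1.
- by move=> _ ->.
- by move=> y Vy; exists V.
- by move=> y [_ -> /VU].
Qed.

Lemma invS_lt (R : realType) (e : R) : 0 < e -> exists n : nat, n.+1%:R^-1 < e.
Proof. by move=> /ltr_add_invr[n]; rewrite add0r; exists n. Qed.

Lemma invS_le (R : realType) (n m : nat) :
  (n <= m)%N -> (m.+1%:R^-1 : R) <= n.+1%:R^-1.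
Proof. by move=> nm; rewrite lef_pV2 ?posrE// ler_nat. Qed.

Lemma invS_gt0 (R : realType) (n : nat) : 0 < n.+1%:R^-1 :> R.
Proof. by rewrite invr_gt0. Qed.

(** This set is closed in the compact set K and omits the added point, so it is
    a compact part of the subspace X. *)
Lemma annulus_compact (R : realType) (X : topologicalType)
    (Y : topology (option X)) (d : tspace Y -> tspace Y -> R)
    (K : set (tspace Y)) (a b : R) :
  extension R Y -> metrizes d -> compact K -> 0 < a ->
  [set y | d None y <= b] `<=` K ->
  compact [set x : X | a <= d None (Some x) <= b].
Proof.
move=> eY dY cK a0 bK.
pose L := [set y : tspace Y | a <= d None y <= b].
have cL : compact L.
  apply: subclosed_compact cK _.
    by apply: (lipschitz_closed dY) => x y; exact: (mdtri dY).
  by move=> y /andP[_ yb]; exact: bK.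
move=> F PF FL.
have [|[x|] [/= Lx clx]] := cL ((Some : X -> tspace Y) @ F) _ _.
- exact: FL.
- exists x; split => // A U FA /(extension_nbhs eY)[V xV VU].
  have FA' : ((Some : X -> tspace Y) @ F)
      ((Some : X -> tspace Y) @` A).
    apply: (@filterS _ F _ A _ _ FA) => y Ay; exact: imageP.
  have [_ [[y Ay <-] Vy]] := clx _ _ FA' xV.
  by exists y; split=> //; exact: VU.
- by move: Lx => /andP[]; rewrite (mdxx dY); lra.
Qed.

Definition pair_code (n m : nat) : nat := pickle (n, m).

Definition pair_decode (p : nat) : nat * nat := odflt (0, 0)%N (unpickle p).

Lemma pair_codeK n m : pair_decode (pair_code n m) = (n, m).
Proof. by rewrite /pair_decode pickleK. Qed.

Section upper_bound.
Variables (R : realType) (X : topologicalType) (B : set (set X)).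
Hypothesis basisB : basis B.

(** Let p be the added point.  Inside a compact neighbourhood of p, the
    punctured ball of radius e(n+1) is a countable union of compact annuli,
    each of which is covered by countably many basic open sets contained in
    the ball of radius e(n).  So countably many basic sets have a union lying
    between two consecutive punctured balls, and these unions generate the
    neighbourhoods of p; the double sequence of basic sets is listed through
    [pair_code]. *)
Lemma extension_code (Y : topology (option X)) :
  extension R Y -> locally_compact [set: tspace Y] ->
  exists2 u : nat -> set X, sequences_in B u &
    forall A : set (tspace Y), nbhs (None : tspace Y) A <->
      A None /\ exists n, forall m, u (pair_code n m) `<=` Some @^-1` A.
Proof.
move=> eY lcY; have [[d dY] _ dense_Y] := eY.
have [K NK [cK _]] := locally_compact_nbhs (None : tspace Y) lcY.
have [delta delta0 dK] := (mnbhsP dY _ _).1 NK.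
have [n0 n0d] := invS_lt delta0.
pose e n : R := (n0 + n).+1%:R^-1.
have e0 n : 0 < e n by exact: invS_gt0.
have eS n : e n.+1 < e n by rewrite ltf_pV2 ?posrE// ltr_nat addnS.
have ed n : e n < delta.
  by apply: le_lt_trans n0d; apply: invS_le; exact: leq_addr.
have small n : exists x : X, d None (Some x) < e n.
  have [||y [/= yn [x _ xy]]] := dense_Y [set y | d None y < e n].
  - by exists None; rewrite /= (mdxx dY).
  - exact: (open_mball dY).
  - by exists x; rewrite xy.
have openE n : open [set x : X | d None (Some x) < e n].
  have /continuousP cS := extension_continuous eY.
  by apply: (cS [set y | d None y < e n]); exact: (open_mball dY).
have cover n m : exists S : set (set X), [/\ countable S, S `<=` B,
    [set x | m.+1%:R^-1 <= d None (Some x) <= e n.+1] `<=` \bigcup_(V in S) V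
    & \bigcup_(V in S) V `<=` [set x | d None (Some x) < e n]].
  apply: (compact_cover_basis basisB) => //.
    apply: (annulus_compact eY dY cK) => // y /= ye; apply: dK.
    exact: le_lt_trans ye _.
  by move=> x /= /andP[_ /le_lt_trans]; apply.
have /choice[v vP] n : exists v : nat -> set X, [/\ range v `<=` B,
    [set x | d None (Some x) < e n.+1] `<=` \bigcup_m v m
    & \bigcup_m v m `<=` [set x | d None (Some x) < e n]].
  have /choice[S SP] := cover n.
  have cS : countable (\bigcup_m S m).
    by apply: bigcup_countable => // m _; case: (SP m).
  (* x lies in the annulus of inner radius 1 / (m + 1) if this is < d p x. *)
  have eSub x : d None (Some x) < e n.+1 ->
      exists2 V, (\bigcup_m S m) V & V x.
    move=> xe; have xN : 0 < d None (Some x) by apply: (md_gt0 dY).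
    have [m mx] := invS_lt xN; have [_ _ Sx _] := SP m.
    have [|V SV Vx] := Sx x; first by rewrite /= (ltW mx) (ltW xe).
    by exists V => //; exists m.
  have /pfcard_geP[S0|[v]] := cS.
    by have [x /eSub[V]] := small n.+1; rewrite S0.
  have vS m : (\bigcup_m S m) (v m) by exact: funS.
  exists v; split.
  - move=> _ [m _ <-]; have [k _ Sk] := vS m.
    by have [_ SB _ _] := SP k; exact: SB.
  - move=> x /eSub[V SV Vx]; have [m _ vm] : range v V by apply: surj.
    by exists m => //; rewrite vm.
  - move=> x [m _ vx]; have [k _ Sk] := vS m.
    by have [_ _ _ Se] := SP k; apply: Se; exists (v m).
exists (fun p => v (pair_decode p).1 (pair_decode p).2).
  move=> _ [p _ <-]; have [vB _ _] := vP (pair_decode p).1.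
  by apply: vB; exists (pair_decode p).2.
move=> A; split=> [NA|[AN [n nA]]].
  split; first exact: (@nbhs_singleton (tspace Y) None A NA).
  have [eps eps0 epsA] := (mnbhsP dY _ _).1 NA.
  have [n ne] := invS_lt eps0; exists n => m x; rewrite pair_codeK /= => vx.
  apply: epsA; rewrite /=; apply: lt_trans _ ne.
  have [_ _ ve] := vP n; apply: (@lt_le_trans _ _ (e n)).
    by apply: ve; exists m.
  by apply: invS_le; exact: leq_addl.
apply/(mnbhsP dY); exists (e n.+1) => // -[x|//] /= xe.
have [_ ve _] := vP n; have [m _ vx] := ve x xe.
by apply: (nA m); rewrite pair_codeK.
Qed.

Lemma card_lc_extensions_le : lc_extensions R X #<= sequences_in B.
Proof.
have /choice[u uP] (c : set (topology (option X))) : exists u : nat -> set X,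
    lc_extensions R X c -> sequences_in B u /\ exists2 Y, extension R Y &
    c = ext_class R Y /\ forall A : set (tspace Y), nbhs (None : tspace Y) A <->
      A None /\ exists n, forall m, u (pair_code n m) `<=` Some @^-1` A.
  have [[[Y eY <-] lcc]|nc] := pselect (lc_extensions R X c); last first.
    by exists (fun=> set0) => /nc.
  have [|u uB uY] := extension_code eY.
    by apply: lcc; split=> //; exact: ext_equiv_refl.
  by exists u => _; split=> //; exists Y.
apply: (set_inj_card_le (f := u)); first by move=> c /uP[].
move=> c c'; rewrite !inE => /uP[_ [Y eY [-> uY]]] /uP[_ [Z eZ [-> uZ]]] E.
rewrite (extension_eq eY eZ)//; apply/seteqP; split => A.
  by move=> /(uY A); rewrite E => /(uZ A).
by move=> /(uZ A); rewrite -E => /(uY A).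
Qed.

End upper_bound.

(** * Adding a point to a metric space *)

Section metric_topology.
Variables (R : realType) (T : choiceType) (D : T -> T -> R).
Hypotheses (D0 : forall x y, D x y = 0 <-> x = y)
  (DC : forall x y, D x y = D y x)
  (Dtri : forall x y z, D x z <= D x y + D y z).

Let mopen : set (set T) :=
  [set U | forall x, U x -> exists2 e : R, 0 < e & [set y | D x y < e] `<=` U].

Let mopenT : mopen [set: T].
Proof. by move=> x _; exists 1. Qed.

Let mopenI : setI_closed mopen.
Proof.
move=> U V oU oV x [/oU[e e0 eU] /oV[f f0 fV]].
exists (Num.min e f); first by rewrite lt_min e0.
by move=> y /=; rewrite lt_min => /andP[ye yf]; split; [exact: eU|exact: fV].
Qed.

Let mopen_bigcup (F : set (set T)) :
  F `<=` mopen -> mopen (\bigcup_(A in F) A).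
Proof.
move=> Fo x [A FA Ax]; have [e e0 eA] := Fo _ FA x Ax.
by exists e => // y /eA Ay; exists A.
Qed.

Definition metric_topology : topology T :=
  Topology mopenT mopenI mopen_bigcup.

Lemma metric_topologyP : metrizes (D : tspace metric_topology -> _ -> R).
Proof.
split=> // x A; rewrite nbhsE; split=> [[U [oU Ux] UA]|[e e0 eA]].
  by have [e e0 eU] := oU x Ux; exists e => //; exact: subset_trans UA.
exists [set y | D x y < e] => //; split; last by rewrite /= (D0 x x).2.
move=> y /= xy; exists (e - D x y); first by rewrite subr_gt0.
by move=> z /= yz; have := Dtri x y z; lra.
Qed.

End metric_topology.

(** Let d be a metric on X and q a positive weight.  Adding a point p at
    distance g(x) = inf_y (d x y + q y) from x, and letting paths between
    points of X pass through p, gives the metric [pinched] on X and p: the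
    triangle inequality holds because g is 1-Lipschitz for d, and the topology
    of X is unchanged because g is positive, which is where q has to be locally
    bounded below.  The sets {g < e} are the punctured balls at p.  If moreover
    q is 1 off W and proper on W, and W is at distance at least 1 from its
    complement, then g is at least 1 off W and {e <= g <= 1/2} is a compact part
    of W for every e > 0; so p has a compact neighbourhood. *)
Section pinching.
Variables (R : realType) (X : topologicalType) (d : X -> X -> R).
Variables (q : X -> R) (W : set X).
Hypotheses (dX : metrizes d) (q_gt0 : forall x, 0 < q x)
  (q_locally_bounded : forall x : X,
    exists2 e : R, 0 < e & nbhs x [set y : X | e <= q y])
  (q_out : forall x, ~ W x -> q x = 1)
  (dW : forall x y, W x -> ~ W y -> 1 <= d x y)
  (q_proper : forall e : R, 0 < e ->
    relatively_compact [set x | W x /\ e <= q x])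
  (q_small : forall e : R, 0 < e -> exists x, q x < e).

Definition pinch (x : X) : R := inf [set d x y + q y | y in [set: X]].

Let pinch_has_inf x : has_inf [set d x y + q y | y in [set: X]].
Proof.
split; first by exists (d x x + q x); exists x.
by exists 0 => _ [y _ <-]; rewrite addr_ge0 ?(md_ge0 dX)// ltW.
Qed.

Lemma pinch_le x y : pinch x <= d x y + q y.
Proof. by apply: ge_inf; [case: (pinch_has_inf x)|exists y]. Qed.

Lemma pinch_ge x a : (forall y, a <= d x y + q y) -> a <= pinch x.
Proof.
move=> H; apply: lb_le_inf; first by case: (pinch_has_inf x).
by move=> _ [y _ <-].
Qed.

Lemma pinch_le_q x : pinch x <= q x.
Proof. by have := pinch_le x x; rewrite (mdxx dX) add0r. Qed.

Lemma pinch_lip x y : pinch x <= d x y + pinch y.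
Proof.
suff: pinch x - d x y <= pinch y by lra.
by apply: pinch_ge => z; have := pinch_le x z; have := mdtri dX y x z; lra.
Qed.

Lemma pinch_gt0 x : 0 < pinch x.
Proof.
have [e e0 /(mnbhsP dX)[f f0 fe]] := q_locally_bounded x.
have m0 : 0 < Num.min e f by rewrite lt_min e0.
apply: lt_le_trans m0 _; apply: pinch_ge => y; rewrite ge_min.
have [xy|fxy] := ltP (d x y) f.
  have := fe y xy; have := md_ge0 dX x y; rewrite /= => ? ?.
  by apply/orP; left; lra.
by have := q_gt0 y; move=> ?; apply/orP; right; lra.
Qed.

Lemma pinch_out x : ~ W x -> 1 <= pinch x.
Proof.
move=> nWx; apply: pinch_ge => y.
have [Wy|nWy] := pselect (W y).
  by have := dW Wy nWx; rewrite (mdC dX) => ?; have := q_gt0 y; lra.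
by rewrite q_out//; have := md_ge0 dX x y; lra.
Qed.

Definition pinched (a b : option X) : R :=
  match a, b with
  | Some x, Some y => Num.min (d x y) (pinch x + pinch y)
  | Some x, None | None, Some x => pinch x
  | None, None => 0
  end.

Let pinched0 a b : pinched a b = 0 <-> a = b.
Proof.
split; last first.
  move=> ->; case: b => //= x; rewrite (mdxx dX) min_l//.
  by have := pinch_gt0 x; lra.
case: a b => [x|] [y|] //=.
- have x0 := pinch_gt0 x; have y0 := pinch_gt0 y.
  case: (leP (d x y) _) => _; last by move=> ?; exfalso; lra.
  by move/(md0 dX) ->.
- by have := pinch_gt0 x => /[swap] ->; rewrite ltxx.
- by have := pinch_gt0 y => /[swap] ->; rewrite ltxx.
Qed.

Let pinchedC a b : pinched a b = pinched b a.
Proof. by case: a b => [x|] [y|] //=; rewrite (mdC dX) addrC. Qed.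

Let pinched_tri a b c : pinched a c <= pinched a b + pinched b c.
Proof.
case: a b c => [x|] [y|] [z|] /=; rewrite ?ge_min.
- have := mdtri dX y x z; have := pinch_lip x y; have := pinch_lip z y.
  rewrite (mdC dX z y) => ? ? ?; have ? := pinch_gt0 y.
  by case: (leP (d x y) _) => _; case: (leP (d y z) _) => _; apply/orP;
    (by left; lra) || (by right; lra).
- have ? := pinch_lip x y; have ? := pinch_gt0 y.
  by case: (leP (d x y) _) => _; lra.
- by apply/orP; right; lra.
- by have := pinch_gt0 x; lra.
- have := pinch_lip z y; rewrite (mdC dX z y) => ?; have ? := pinch_gt0 y.
  by case: (leP (d y z) _) => _; lra.
- by have := pinch_gt0 y; lra.
- by lra.
- by lra.
Qed.

Definition pinched_topology : topology (option X) :=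
  metric_topology pinched.

Lemma pinched_metrizes :
  metrizes (pinched : tspace pinched_topology -> tspace pinched_topology -> R).
Proof. exact: metric_topologyP. Qed.

Let Y := tspace pinched_topology.

Let some_continuous : continuous (Some : X -> Y).
Proof.
move=> x U /(mnbhsP pinched_metrizes)[e e0 eU]; apply/(mnbhsP dX).
by exists e => // y /= xy; apply: eU; rewrite /= gt_min xy.
Qed.

Lemma pinched_extension : extension R pinched_topology.
Proof.
split; first by exists (pinched : Y -> Y -> R); exact: pinched_metrizes.
- apply/seteqP; split => [U oU|_ [V oV <-]]; last first.
    by move/continuousP: some_continuous; apply.
  exists (Some @` U); last first.
    by apply/seteqP; split => [x [y Uy [<-]]//|x Ux]; exists x.
  rewrite openE => _ [x Ux <-]; apply/(mnbhsP pinched_metrizes).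
  have /(mnbhsP dX)[e e0 eU] : nbhs x U by apply: open_nbhs_nbhs.
  exists (Num.min e (pinch x)); first by rewrite lt_min e0 pinch_gt0.
  move=> [y|] /=; last by rewrite lt_min ltxx andbF.
  have ? := pinch_gt0 y; rewrite lt_min => /andP[].
  case: (leP (d x y) _) => _ xy ?; last by exfalso; lra.
  by exists y => //; exact: eU.
move=> O [[x|] Ox] oO; first by exists (Some x); split=> //; exists x.
have /(mnbhsP pinched_metrizes)[e e0 eO] : nbhs (None : Y) O.
  by apply: open_nbhs_nbhs.
have [x qx] := q_small e0; exists (Some x); split; last by exists x.
by apply: eO; rewrite /=; exact: le_lt_trans (pinch_le_q x) qx.
Qed.

(** A filter on this ball that does not cluster at p contains the compact set
    {e <= g <= 1/2} for some e > 0. *)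
Let near_None_compact : compact [set a : Y | pinched None a <= 2^-1].
Proof.
move=> F PF FH.
have [?|/existsNP[A /existsNP[V /not_implyP[FA /not_implyP[NV AV]]]]] :=
    pselect (cluster F (None : Y)).
  by exists None; split => //=.
have [e e0 eV] := (mnbhsP pinched_metrizes _ _).1 NV.
pose K := [set x | e <= pinch x <= 2^-1].
have cK : compact K.
  have [L cL qL] := q_proper e0; apply: subclosed_compact cL _.
    apply: (lipschitz_closed dX) => x y; rewrite (mdC dX) addrC.
    exact: pinch_lip.
  move=> x /andP[xe x2]; apply: qL.
  split; last exact: le_trans xe (pinch_le_q x).
  by apply: contrapT => /pinch_out; lra.
have cSK : compact ((Some : X -> Y) @` K).
  apply: continuous_compact cK; apply: continuous_subspaceT.
  exact: some_continuous.
have [|a [[x /andP[_ xK] <-] clx]] := cSK F PF; last by exists (Some x).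
apply: filterS (filterI FA FH) => -[x|] [Ax /= x2].
  exists x => //; apply/andP; split=> //; rewrite leNgt; apply/negP => xe.
  by apply: AV; exists (Some x); split=> //; exact: eV.
by case: AV; exists None; split=> //; exact: (@nbhs_singleton Y None V NV).
Qed.

Lemma pinched_locally_compact : locally_compact [set: X] ->
  locally_compact [set: tspace pinched_topology].
Proof.
move=> lcX; apply: (metrizes_locally_compact pinched_metrizes) => -[x|].
  have [K xK [cK _]] := locally_compact_nbhs x lcX.
  have [U xU UK] := extension_nbhs pinched_extension xK.
  have xN : 0 < pinched (Some x) None by exact: pinch_gt0.
  exists (U `&` [set a | pinched (Some x) a < pinched (Some x) None]).
    by apply: filterI => //; exact: (mnbhs_ball pinched_metrizes (Some x) xN).
  exists ((Some : X -> Y) @` K).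
    apply: continuous_compact cK; apply: continuous_subspaceT.
    exact: some_continuous.
  by move=> [y|] [Uy /=]; [exists y => //; exact: UK|rewrite ltxx].
have h0 : (0 : R) < 2^-1 by lra.
exists [set a : Y | pinched None a < 2^-1].
  exact: (mnbhs_ball pinched_metrizes (None : Y) h0).
by exists [set a : Y | pinched None a <= 2^-1] => // a /= /ltW.
Qed.

Lemma pinched_nbhs_None_W :
  nbhs (None : tspace pinched_topology) [set a | forall x, a = Some x -> W x].
Proof.
apply/(mnbhsP pinched_metrizes); exists 1 => // -[y|//] /= y1 x [<-].
by apply: contrapT => /pinch_out; lra.
Qed.

Lemma pinched_nbhs_None (A : set (tspace pinched_topology)) :
  nbhs (None : tspace pinched_topology) A ->
  exists2 e : R, 0 < e & forall x, q x < e -> A (Some x).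
Proof.
move=> /(mnbhsP pinched_metrizes)[e e0 eA]; exists e => // x qx; apply: eA.
exact: le_lt_trans (pinch_le_q x) qx.
Qed.

End pinching.

(** * Extensions from a partition into clopen pieces *)

(** The fibres of the locally constant map c are clopen and pairwise disjoint,
    and N exhausts each of them by relatively compact sets, every compact set
    being covered by finitely many stages; so the fibres form a partition of
    X into clopen sigma-compact pieces. *)
Definition fibered_exhaustion (X : topologicalType) (T : Type)
    (c : X -> T) (N : X -> nat) : Prop :=
  (forall x : X, exists m, nbhs x [set y : X | c y = c x /\ (N y <= m)%N]) /\
  forall i m, relatively_compact [set x : X | c x = i /\ (N x <= m)%N].

Section fibered.
Variables (R : realType) (X : topologicalType) (T : choiceType).
Variables (c : X -> T) (N : X -> nat).
Hypotheses (mX : metrizable R X) (lcX : locally_compact [set: X])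
  (cN : fibered_exhaustion c N).

(** Adding 1 to the distances between different fibres does not change the
    topology, the fibres being open. *)
Lemma fibered_metric : exists2 d : X -> X -> R, metrizes d &
  forall x y, c x <> c y -> 1 <= d x y.
Proof.
have [d dX] := mX.
exists (fun x y => d x y + (c x != c y)%:R); last first.
  by move=> x y /eqP ->; rewrite lerDr (md_ge0 dX).
split.
- move=> x y; split=> [|->]; last by rewrite (mdxx dX) eqxx addr0.
  have := md_ge0 dX x y; case: (c x != c y) => /= ? E; first by exfalso; lra.
  by apply: (md0 dX); lra.
- by move=> x y; rewrite (mdC dX) eq_sym.
- move=> x y z; have := mdtri dX y x z; case: (c x =P c z) => [_|xz] /=.
    by case: (c x != c y); case: (c y != c z) => /=; lra.
  case: (c x =P c y) => [xy|_]; case: (c y =P c z) => [yz|_] /=; try lra.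
  by case: xz; rewrite xy.
move=> x A; split=> [|[e e0 eA]].
  move=> /(mnbhsP dX)[e e0 eA]; exists e => // y /= xy; apply: eA => /=.
  by apply: le_lt_trans xy; rewrite lerDl.
have [m xm] := cN.1 x.
apply: filterS (filterI xm (mnbhs_ball dX x e0)) => y [/= [cy _] xy].
by apply: eA; rewrite /= cy eqxx addr0.
Qed.

Section sequence_at_infinity.
Variable u : nat -> T.
Hypotheses (u_inj : injective u) (u_c : forall k, range c (u k)).

(** The weight of a point in the k-th chosen fibre tends to 0 both with k and
    along the exhaustion of that fibre. *)
Let q (x : X) : R :=
  if pselect (exists k, u k = c x) is left h then (sval (cid h) + N x).+1%:R^-1
  else 1.

Let qE k x : u k = c x -> q x = (k + N x).+1%:R^-1.
Proof.
move=> ux; rewrite /q; case: pselect => [h|[]]; last by exists k.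
by case: (cid h) => k' /=; rewrite -ux => /u_inj ->.
Qed.

Let qE1 x : ~ (exists k, u k = c x) -> q x = 1.
Proof. by rewrite /q; case: pselect. Qed.

(** The added point is the limit of the fibres over u 0, u 1, and so on, the
    other fibres being far from it.  A given neighbourhood of the added point
    contains all of these fibres except finitely many. *)
Lemma extension_along : exists Y : topology (option X),
  [/\ extension R Y, locally_compact [set: tspace Y],
    nbhs (None : tspace Y) [set a | forall x, a = Some x -> range u (c x)]
  & forall A : set (tspace Y), nbhs (None : tspace Y) A ->
      exists k0, forall k x, (k0 <= k)%N -> c x = u k -> A (Some x)].
Proof.
have [d dX dc] := fibered_metric.
pose W := [set x | exists k, u k = c x].
have q_gt0 x : 0 < q x.
  have [[k /qE->]|/qE1->//] := pselect (W x); exact: invS_gt0.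
have q_loc (x : X) : exists2 e : R, 0 < e & nbhs x [set y : X | e <= q y].
  have [m xm] := cN.1 x; have [[k kx]|nWx] := pselect (W x).
    exists (k + m).+1%:R^-1; first exact: invS_gt0.
    apply: filterS xm => y /= [cy Ny]; rewrite (@qE k) ?cy//.
    by apply: invS_le; rewrite leq_add2l.
  exists 1 => //; apply: filterS xm => y /= [cy _].
  by rewrite qE1// cy.
have q_proper (e : R) : 0 < e -> relatively_compact [set x | W x /\ e <= q x].
  move=> /invS_lt[n ne].
  apply: (@relatively_compactS _ _
    (\bigcup_(k in `I_n) [set x | c x = u k /\ (N x <= n)%N])); last first.
    apply: relatively_compact_bigcup => [|k _]; first exact: finite_II.
    exact: cN.2.
  move=> x [[k kx]]; rewrite (qE kx) => /(lt_le_trans ne).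
  rewrite ltf_pV2 ?posrE// ltr_nat ltnS => kn.
  exists k => /=; first exact: leq_ltn_trans (leq_addr _ _) kn.
  by split=> //; exact: leq_trans (leq_addl _ _) (ltnW kn).
have q_small (e : R) : 0 < e -> exists x, q x < e.
  move=> /invS_lt[n ne]; have [x _ cx] := u_c n; exists x.
  rewrite (qE (esym cx)); apply: le_lt_trans ne; apply: invS_le.
  exact: leq_addr.
have dW x y : W x -> ~ W y -> 1 <= d x y.
  by move=> [k kx] nWy; apply: dc => E; apply: nWy; exists k; rewrite kx.
exists (pinched_topology d q); split.
- exact: pinched_extension.
- exact: (pinched_locally_compact (W := W)).
- have := pinched_nbhs_None_W dX q_gt0 q_loc qE1 dW.
  apply: filterS => a aW x ax; have [k kx] := aW x ax.
  by exists k.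
move=> A /(pinched_nbhs_None dX q_gt0 q_loc)[e /invS_lt[n ne] eA].
exists n => k x nk cx; apply: eA; apply: le_lt_trans ne.
rewrite (qE (esym cx)); apply: invS_le.
exact: leq_trans nk (leq_addr _ _).
Qed.

End sequence_at_infinity.

(** A sequence f is sent to an extension along the fibres indexed by the codes
    of its initial segments.  If f and g differ at n, no initial segment of f of
    length greater than n is one of g, so the two index sets are almost
    disjoint and the two added points have different neighbourhoods. *)
Lemma card_sequences_le_lc_extensions (U : Type) (S : set U) :
  infinite_set (range c) -> S #<= range c ->
  sequences_in S #<= lc_extensions R X.
Proof.
move=> infc Sc; have c0 := infinite_setN0 infc.
have [phi phic phiI] := card_le_fun Sc c0.
have [code codec codeI] := card_le_fun (card_seqs_in infc) c0.
pose u (f : nat -> U) k := code (mkseq (phi \o f) k).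
have seq_c f k : sequences_in S f -> seqs_in (range c) (mkseq (phi \o f) k).
  by move=> fS x /mapP[n _ ->]; apply: phic; apply: fS; exists n.
have uI f g k l : sequences_in S f -> sequences_in S g ->
    u f k = u g l -> k = l /\ forall n, (n < k)%N -> f n = g n.
  move=> fS gS /codeI; rewrite !inE => /(_ (seq_c _ _ fS) (seq_c _ _ gS)) E.
  have kl : k = l by rewrite -(size_mkseq (phi \o f) k) E size_mkseq.
  split=> // n nk; apply: phiI; rewrite ?inE.
  - by apply: fS; exists n.
  - by apply: gS; exists n.
  have := congr1 (fun s => nth (phi (f n)) s n) E.
  by rewrite !nth_mkseq// -kl.
have /choice[Y YP] f : exists Y : topology (option X), sequences_in S f ->
  [/\ extension R Y, locally_compact [set: tspace Y],
    nbhs (None : tspace Y) [set a | forall x, a = Some x -> range (u f) (c x)]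
  & forall A : set (tspace Y), nbhs (None : tspace Y) A ->
      exists k0, forall k x, (k0 <= k)%N -> c x = u f k -> A (Some x)].
  have [fS|nfS] := pselect (sequences_in S f); last first.
    (* The choice made outside [sequences_in S] is arbitrary. *)
    by exists (metric_topology (fun _ _ : option X => 0 : R)) => /nfS.
  have [||Y YP] := @extension_along (u f).
  - by move=> k l /uI-/(_ fS fS)[].
  - by move=> k; apply: codec; exact: seq_c.
  - by exists Y.
apply: (set_inj_card_le (f := fun f => ext_class R (Y f))).
  by move=> f /YP[eY lcY _ _]; exact: ext_class_lc.
move=> f g; rewrite !inE => fS gS /= E; apply/funext => n.
have [eY _ _ nearf] := YP f fS; have [eZ _ nearg _] := YP g gS.
move: nearg; rewrite -(ext_class_inj eY eZ E) => /nearf[k0 k0P].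
have [x _ cx] : range c (u f (maxn k0 n.+1)) by apply: codec; exact: seq_c.
have [l _ gl] := k0P _ _ (leq_maxl _ _) cx x erefl.
have [_ ->//] := uI _ _ _ _ fS gS (etrans (esym cx) (esym gl)).
exact: leq_maxr.
Qed.

(** Each stage {c = i, N <= m} is covered by finitely many balls of radius
    1 / (k + 1); p lists their centres, j being the position in the list for
    (i, m, k). *)
Lemma fibered_centers (x0 : X) (d : X -> X -> R) : metrizes d ->
  exists p : T * (nat * nat * nat) -> X, forall x k,
    exists m j, d (p (c x, (m, k, j))) x < k.+1%:R^-1.
Proof.
move=> dX.
have /choice[s sP] (imk : T * nat * nat) : exists s : seq X,
    forall x, c x = imk.1.1 /\ (N x <= imk.1.2)%N ->
    exists2 y, y \in s & d y x < imk.2.+1%:R^-1.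
  case: imk => [[i m] k] /=.
  have [K cK KP] := cN.2 i m.
  suff [s sP] : exists s : seq X, forall x, K x ->
      exists2 y, y \in s & d y x < k.+1%:R^-1.
    by exists s => x /KP/sP.
  apply: (compact_induction (Q := fun A => exists s : seq X, forall x, A x ->
      exists2 y, y \in s & d y x < k.+1%:R^-1)) cK _.
  - by exists [::].
  - by move=> A B AB [s sP]; exists s => x /AB/sP.
  - move=> A B [s sP] [t tP]; exists (s ++ t) => x [/sP|/tP] [y ys yx];
      by exists y; rewrite // mem_cat ys ?orbT.
  move=> x _; exists [set y | d x y < k.+1%:R^-1].
    by apply: (mnbhs_ball dX); exact: invS_gt0.
  by exists [:: x] => y xy; exists x => //; rewrite inE.
exists (fun t => nth x0 (s (t.1, t.2.1.1, t.2.1.2)) t.2.2) => x k.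
have [|y ys yx] := sP (c x, N x, k) x; first by [].
by exists (N x), (index y (s (c x, N x, k))); rewrite /= nth_index.
Qed.

(** The balls of radius 1 / (k + 1) around these centres form a base. *)
Lemma fibered_weight (x0 : X) : infinite_set (range c) ->
  weight X #<= range c.
Proof.
move=> infc; have [d dX] := mX; have [p pP] := fibered_centers x0 dX.
pose F (t : T * (nat * nat * nat)) := [set y | d (p t) y < t.2.1.2.+1%:R^-1].
have basisF : basis [set F t | t in range c `*` [set: nat * nat * nat]].
  split=> [_ [t _ <-]|x A /(mnbhsP dX)[e e0 eA]]; first exact: (open_mball dX).
  have [|k ke] := @invS_lt R (e / 2); first by lra.
  have [m [j px]] := pP x k.
  exists (F (c x, (m, k, j))); first split=> //.
    by exists (c x, (m, k, j)) => //; split=> //=; exists x.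
  move=> y; rewrite /F /= => py; apply: eA => /=.
  have := lt_trans py ke; have := lt_trans px ke.
  by have := mdtri dX (p (c x, (m, k, j))) x y; rewrite (mdC dX x (p _)); lra.
apply: card_le_trans ((weightP X).2 _ basisF) _.
apply: card_le_trans (card_image_le _ _) _.
apply: card_le_trans (card_setX_nat infc).
apply: (set_inj_card_le
  (f := fun t : T * (nat * nat * nat) => (t.1, pickle t.2))).
  by move=> t [].
by move=> [i a] [j b] _ _ /= [-> /(pcan_inj pickleK) ->].
Qed.

Lemma fibered_separable (x0 : X) : countable (range c) -> separable X.
Proof.
move=> cc; have [d dX] := mX; have [p pP] := fibered_centers x0 dX.
exists (p @` (range c `*` [set: nat * nat * nat])).
  apply: sub_countable (card_image_le _ _) _.
  by apply: countableX => //; exact: countableP.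
move=> O [x Ox] oO.
have /(mnbhsP dX)[e e0 eO] : nbhs x O by apply: open_nbhs_nbhs.
have [k ke] := invS_lt e0; have [m [j px]] := pP x k.
exists (p (c x, (m, k, j))); split.
  by apply: eO; rewrite /= (mdC dX); exact: lt_trans px ke.
by exists (c x, (m, k, j)) => //; split=> //=; exists x.
Qed.

End fibered.

(** * Partitions of non-separable and of zero-dimensional spaces *)

Section chain_components.
Variables (R : realType) (X : topologicalType) (d : X -> X -> R).
Hypotheses (dX : metrizes d) (lcX : locally_compact [set: X]).

Let ball x e := [set y | d x y < e].

(** rho x is the supremum, truncated at 1, of the radii of the relatively
    compact balls at x; the truncation makes the set below nonempty. *)
Let bad (x : X) : set R :=
  [set e | 0 < e /\ (1 <= e \/ ~ relatively_compact (ball x e))].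

Let rho x := inf (bad x).

Let bad_has_inf x : has_inf (bad x).
Proof.
split; first by exists 1; split=> //; left.
by exists 0 => e [/ltW].
Qed.

Let rho_lip x y : rho x <= rho y + d x y.
Proof.
suff: rho x - d x y <= rho y by lra.
apply: lb_le_inf => [|e [e0 ey]]; first by case: (bad_has_inf y).
have d0 := md_ge0 dX x y.
suff : rho x <= e + d x y by lra.
apply: ge_inf; first by case: (bad_has_inf x).
split; first by lra.
have [e1|nrc] := ey; [left|right]; first by lra.
move=> rc; apply: nrc; apply: relatively_compactS rc => z.
by rewrite /ball /= => yz; have := mdtri dX y x z; lra.
Qed.

Let rho_gt0 x : 0 < rho x.
Proof.
have [K /(mnbhsP dX)[e e0 eK] [cK _]] := locally_compact_nbhs x lcX.
have m0 : 0 < Num.min e 1 by rewrite lt_min e0 ltr01.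
apply: lt_le_trans m0 _; apply: lb_le_inf => [|f [f0 fx]].
  by case: (bad_has_inf x).
rewrite ge_min; have [->|nrc] := fx; first by rewrite orbT.
apply/orP; left; rewrite leNgt; apply/negP => fe; apply: nrc.
by exists K => // y /= xy; apply: eK; rewrite /=; apply: lt_trans xy _.
Qed.

Let rho_ball x e : e < rho x -> relatively_compact (ball x e).
Proof.
move=> ex; have [e0|e0] := ltP 0 e; last first.
  apply: relatively_compactS (@relatively_compact0 X) => y.
  by rewrite /ball /=; have := md_ge0 dX x y; lra.
apply: contrapT => nrc; have : rho x <= e.
  by apply: ge_inf; [case: (bad_has_inf x)|split=> //; right].
lra.
Qed.

(** Linked points are so close that the points linked to a compact set form a
    relatively compact set ([step_relatively_compact]); the constant 4 leaves
    room for the variation of rho, which is 1-Lipschitz. *)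
Let linked x y := 4 * d x y < rho x \/ 4 * d x y < rho y.

Let linkedC x y : linked x y -> linked y x.
Proof. by rewrite /linked (mdC dX y x) => -[]; [right|left]. Qed.

Let linkedxx x : linked x x.
Proof. by left; rewrite (mdxx dX) mulr0. Qed.

Let linked_near x y : linked x y -> 3 * d x y < rho x.
Proof.
have := md_ge0 dX x y; have := rho_lip y x.
by rewrite (mdC dX y x) => ? ? [|] ?; lra.
Qed.

Let step (A : set X) : set X := [set z | exists2 y, A y & linked y z].

Let step_relatively_compact A :
  relatively_compact A -> relatively_compact (step A).
Proof.
move=> [K cK AK]; apply: (@relatively_compactS _ _ (step K)).
  by move=> z [y /AK Ky yz]; exists y.
apply: (compact_induction (Q := fun A => relatively_compact (step A))) cK _.
- by apply: relatively_compactS (@relatively_compact0 X) => z [].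
- by move=> B C BC; apply: relatively_compactS => z [y /BC Cy yz]; exists y.
- move=> B C rB rC; apply: relatively_compactS (relatively_compactU rB rC).
  by move=> z [y [By|Cy] yz]; [left|right]; exists y.
move=> x _; have rx := rho_gt0 x; exists (ball x (rho x / 8)).
  by apply: (mnbhs_ball dX); lra.
have r2 : rho x / 2 < rho x by lra.
apply: relatively_compactS (rho_ball r2) => z [y xy /linked_near yz].
rewrite /ball /= in xy *; have := mdtri dX y x z; have := rho_lip y x.
by rewrite (mdC dX y x); lra.
Qed.

Let chain n (x : X) : set X := iter n step [set x].

Let chain_relatively_compact n x : relatively_compact (chain n x).
Proof.
elim: n => [|n IH]; last exact: step_relatively_compact.
by exists [set x] => //; exact: compact_set1.
Qed.

Let chainS n x : chain n x `<=` chain n.+1 x.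
Proof. by move=> y xy; exists y. Qed.

Let chain_le m n x : (m <= n)%N -> chain m x `<=` chain n x.
Proof.
move=> /subnKC <-; elim: (n - m)%N => [|k IH]; first by rewrite addn0.
by rewrite addnS; apply: subset_trans IH _; exact: chainS.
Qed.

Let comp x := \bigcup_n chain n x.

Let comp_linked x y z : comp x y -> linked y z -> comp x z.
Proof. by move=> [n _ xy] yz; exists n.+1 => //; exists y. Qed.

Let comp_min x (A : set X) : A x -> (forall y z, A y -> linked y z -> A z) ->
  comp x `<=` A.
Proof.
move=> Ax clA y [n _]; elim: n y => [y ->//|n IH y [z /IH Az zy]].
exact: clA Az zy.
Qed.

Let compxx x : comp x x. Proof. by exists 0%N. Qed.

(** The complement of a component is closed under links, links being
    symmetric. *)
Let compC x y : comp x y -> comp y x.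
Proof.
move=> xy; apply: contrapT => nyx.
have /(_ y xy) : comp x `<=` ~` comp y; last by apply; exact: compxx.
apply: comp_min => // a b nya ab yb; apply: nya.
exact: comp_linked yb (linkedC ab).
Qed.

Let comp_eq x y : comp x y -> comp x = comp y.
Proof.
move=> xy; apply/seteqP; split.
  apply: comp_min => [|a b]; [exact: compC|exact: comp_linked].
by apply: comp_min => // a b; exact: comp_linked.
Qed.

(** The component of x is never empty, so the root depends on the component
    only. *)
Let root x0 x := xget x0 (comp x).

(** The classes of points joined by finite chains of links are open, and the
    points at most n links away from the root of a class form a relatively
    compact set. *)
Lemma fibered_exhaustion_ex (x0 : X) :
  exists (c : X -> X) (N : X -> nat), fibered_exhaustion c N.
Proof.
have rootP x : comp (root x0 x) x.
  by apply: compC; apply: xgetPex; exists x.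
have lev x : exists n, `[< chain n (root x0 x) x >].
  by have [n _ ?] := rootP x; exists n; apply/asboolP.
exists (root x0), (fun x => ex_minn (lev x)); split=> [x|i m].
  case: (ex_minnP (lev x)) => n /asboolP xn _; exists n.+1.
  have rx := rho_gt0 x; have r4 : 0 < rho x / 4 by lra.
  apply: filterS (mnbhs_ball dX x r4) => y /= xy.
  have lxy : linked x y by left; lra.
  have rE : root x0 y = root x0 x.
    by rewrite /root (@comp_eq x y)//; exact: comp_linked lxy.
  split=> //; case: ex_minnP => k _; apply; apply/asboolP.
  by rewrite rE; exists x.
apply: relatively_compactS (chain_relatively_compact m i) => x /= [<-].
by case: ex_minnP => k /asboolP xk _ km; exact: chain_le xk.
Qed.

End chain_components.

(** A countable dense set gives a countable cover of X by compact open sets K p,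
    and x is sent to the first p with x in K p.  The fibres being relatively
    compact, they need no exhaustion. *)
Lemma fibered_exhaustion_clopen (R : realType) (X : topologicalType) (x0 : X) :
  metrizable R X -> locally_compact [set: X] ->
  separable X -> has_clopen_basis X ->
  exists c : X -> nat, fibered_exhaustion c (fun=> 0%N).
Proof.
move=> [d dX] lcX [D cD denseD] [B [_ basisB] Bclopen].
have [e eP] : exists e : nat -> X, forall x r, 0 < r -> exists n, d (e n) x < r.
  have /pfcard_geP[D0|[e]] := cD.
    have [||y []] := denseD [set: X]; [by exists x0|exact: openT|].
    by rewrite D0.
  exists e => x r r0; have [||y [/= xy Dy]] := denseD [set y | d x y < r].
  - by exists x; rewrite /= (mdxx dX).
  - exact: (open_mball dX).
  have [n _ ny] : range e y by apply: surj.
  by exists n; rewrite ny (mdC dX).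
pose good (nk : nat * nat) (K : set X) :=
  [/\ compact K, clopen K & [set y | d (e nk.1) y < nk.2.+1%:R^-1] `<=` K].
have /choice[K KP] (p : nat) : exists K : set X, [/\ compact K, clopen K &
    (exists K', good (pair_decode p) K') -> good (pair_decode p) K].
  have [[K gK]|nK] := pselect (exists K', good (pair_decode p) K').
    by exists K; case: (gK).
  exists set0; split=> //; first exact: compact0.
  by split; [exact: open0|exact: closed0].
have Kcover x : exists p, `[< K p x >].
  have [L xL [cL _]] := locally_compact_nbhs x lcX.
  have [V [BV Vx] VL] := basisB x L xL; have [oV clV] := Bclopen _ BV.
  have /(mnbhsP dX)[r r0 rV] : nbhs x V by apply: open_nbhs_nbhs.
  have r2 : 0 < r / 2 by lra.
  have [k kr] := invS_lt r2; have [n nx] := eP x _ (invS_gt0 R k).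
  exists (pair_code n k); apply/asboolP.
  have [_ _] := KP (pair_code n k); rewrite pair_codeK => gK.
  suff /gK[_ _ /(_ x)] : exists K', good (n, k) K' by apply.
  exists V; split=> //; first exact: subclosed_compact VL.
  move=> y /= ny; apply: rV => /=.
  have := lt_trans nx kr; have := lt_trans ny kr.
  by have := mdtri dX (e n) x y; rewrite (mdC dX x (e n)); lra.
pose c x := ex_minn (Kcover x).
exists c; split=> [x|i m].
  exists 0%N.
  have near1 j : nbhs x [set y | K j y <-> K j x].
    have [_ [oK clK] _] := KP j; have [Kx|nKx] := pselect (K j x).
      have Kn : nbhs x (K j) by apply: open_nbhs_nbhs.
      by apply: filterS Kn => y; split.
    have Kn : nbhs x (~` K j).
      by apply: open_nbhs_nbhs; split=> //; exact: closed_openC.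
    by apply: filterS Kn => y; split.
  have near_x m : nbhs x [set y | forall j, (j <= m)%N -> K j y <-> K j x].
    elim: m => [|m IH].
      by apply: filterS (near1 0%N) => y /= yx j; rewrite leqn0 => /eqP->.
    apply: filterS (filterI IH (near1 m.+1)) => y [/= yx y1] j.
    by rewrite leq_eqVlt => /orP[/eqP->//|]; rewrite ltnS; exact: yx.
  apply: filterS (near_x (c x)) => y /= yx; split=> //.
  rewrite /c; case: (ex_minnP (Kcover x)) yx => p /asboolP Kp pmin.
  rewrite {1}/c; case: (ex_minnP (Kcover x)) => p' /asboolP Kp' pmin' yx.
  case: ex_minnP => p2 /asboolP Kp2 pmin2.
  have p'p : (p' <= p)%N by apply: pmin'; apply/asboolP.
  have pp' : (p <= p')%N by apply: pmin; apply/asboolP.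
  have p2p : (p2 <= p)%N by apply: pmin2; apply/asboolP/(yx p).
  apply/eqP; rewrite eqn_leq p2p /=; apply: pmin; apply/asboolP/(yx p2) => //.
  exact: leq_trans p2p pp'.
have [cK _ _] := KP i; exists (K i) => // x [<- _].
by rewrite /c; case: ex_minnP => p /asboolP.
Qed.

Lemma fibered_range_infinite (X : topologicalType) (T : choiceType)
    (c : X -> T) :
  ~ compact [set: X] -> fibered_exhaustion c (fun=> 0%N) ->
  infinite_set (range c).
Proof.
move=> ncX [_ rc] fc; apply: ncX.
suff [K cK KX] : relatively_compact [set: X].
  by rewrite (_ : setT = K)//; apply/seteqP; split.
have : relatively_compact
    (\bigcup_(i in range c) [set x | c x = i /\ (0 <= 0)%N]).
  by apply: relatively_compact_bigcup => // i _; exact: rc.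
by apply: relatively_compactS => x _; exists (c x) => //; exists x.
Qed.

(** * The number of locally compact one-point extensions *)

Theorem theorem6p2 (R : realType) (X : topologicalType) :
  metrizable R X -> locally_compact [set: X] -> ~ compact [set: X] ->
  (lc_extensions R X #<= sequences_in (weight X)) /\
  (~ separable X \/ has_clopen_basis X ->
     lc_extensions R X #= sequences_in (weight X)).
Proof.
move=> mX lcX ncX.
have le : lc_extensions R X #<= sequences_in (weight X).
  by apply: card_lc_extensions_le; case: (weightP X).
split=> // sep_or_zero; rewrite card_eq_le le /=.
have [x0 _] : [set: X] !=set0.
  apply/set0P/eqP => X0; apply: ncX; rewrite X0; exact: compact0.
have concl (T : choiceType) (c : X -> T) N : fibered_exhaustion c N ->
    infinite_set (range c) -> sequences_in (weight X) #<= lc_extensions R X.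
  move=> cN infc.
  have wc := fibered_weight mX cN x0 infc.
  exact: (card_sequences_le_lc_extensions mX lcX cN infc wc).
have [sX|nsX] := pselect (separable X).
  have clX : has_clopen_basis X by case: sep_or_zero.
  have [c cN] := fibered_exhaustion_clopen x0 mX lcX sX clX.
  exact: concl cN (fibered_range_infinite ncX cN).
have [d dX] := mX; have [c [N cN]] := fibered_exhaustion_ex dX lcX x0.
apply: (concl _ _ _ cN) => /finite_set_countable cc; apply: nsX.
exact: (fibered_separable mX cN x0 cc).
Qed.
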